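(* Let $N\ge2$ be an integer and let $M_N=2\cos\frac{2\pi}{N+3}$ if $N$ is odd, and $M_N=2(1-2\nu_N^2)$ if $N$ is even, where $\nu_N$ is the smallest positive root of the equation $U'_{N+2}(x)=0$. Every $P(z)=z+\sum_{j=2}^Na_jz^j\in\mathcal T_N$ satisfies the estimate $|a_2|\le M_N$, and there exist unique extremal polynomials attaining it: there is exactly one polynomial in $\mathcal T_N$ with $a_2=M_N$, and exactly one polynomial in $\mathcal T_N$ with $a_2=-M_N$.
   Context: $\mathbb D=\{z\in\mathbb C:|z|<1\}$. A holomorphic function $F:\mathbb D\to\mathbb C$ is typically real if $F(z)\in\mathbb R$ for all $z\in\mathbb R\cap\mathbb D$ and $\mathrm{Im}\{F(z)\}\cdot\mathrm{Im}\{z\}>0$ for all $z\in\mathbb D\setminus\mathbb R$. $\mathcal T_N$ is the set of typically real polynomials of the form $P(z)=z+\sum_{j=2}^Na_jz^j$ with $a_j\in\mathbb R$. $U_j$ ($j\ge0$) is the Chebyshev polynomial of the second kind, $U_j(\cos t)=\sin((j+1)t)/\sin t$, and $U_j'$ is its derivative. *)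

(* Defs.v *)
From HB Require Import structures.
From mathcomp Require Import all_boot all_order all_algebra.
From mathcomp Require Import all_classical all_reals all_analysis.
From mathcomp Require Import ring lra complex polyrcf.

Set Implicit Arguments.
Unset Strict Implicit.
Unset Printing Implicit Defensive.

Import Order.TTheory GRing.Theory Num.Theory.
Import numFieldNormedType.Exports.

Local Open Scope classical_set_scope.
Local Open Scope ring_scope.

(* [R[i]^o] is [R[i]] as a one-dimensional normed space over itself, so that
   [derivable] below is complex differentiability. *)
Definition holomorphic_on_disk (R : realType) (F : R[i] -> R[i]) : Prop :=
  forall z : R[i], `|z| < 1 -> derivable (F : R[i]^o -> R[i]^o) z 1.

Definition typically_real (R : realType) (F : R[i] -> R[i]) : Prop :=
  [/\ holomorphic_on_disk F,
      forall z : R[i], `|z| < 1 -> complex.Im z = 0 -> complex.Im (F z) = 0 &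
      forall z : R[i], `|z| < 1 -> complex.Im z <> 0 ->
        0 < complex.Im (F z) * complex.Im z].

Definition complex_horner (R : realType) (p : {poly R}) (z : R[i]) : R[i] :=
  (map_poly (real_complex R) p).[z].

Definition typically_real_poly (R : realType) (N : nat) : set {poly R} :=
  [set p | (exists a : nat -> R,
              p = 'X + \sum_(2 <= j < N.+1) a j *: 'X^j) /\
           typically_real (complex_horner p)].

Fixpoint chebyshevU (R : realType) (n : nat) : {poly R} :=
  match n with
  | 0 => 1
  | 1 => 2%:P * 'X
  | (m.+1 as k).+1 => 2%:P * 'X * chebyshevU R k - chebyshevU R m
  end.

Definition smallest_positive_root (R : realType) (p : {poly R}) : set R :=
  [set x | [/\ 0 < x, root p x & forall y, 0 < y -> root p y -> x <= y]].

(* The default value 0 is never used when [2 <= N], see [nuP]. *)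
Definition nu (R : realType) (N : nat) : R :=
  xget 0 (smallest_positive_root (chebyshevU R N.+2)^`()).

Definition a2_bound (R : realType) (N : nat) : R :=
  if odd N then 2 * cos (2 * pi / N.+3%:R) else 2 * (1 - 2 * nu R N ^+ 2).

Lemma chebyshevUSS (R : realType) (n : nat) :
  chebyshevU R n.+2 = 2%:P * 'X * chebyshevU R n.+1 - chebyshevU R n.
Proof. by []. Qed.

Lemma chebyshevU_cos (R : realType) (n : nat) (t : R) : sin t != 0 ->
  (chebyshevU R n).[cos t] = sin (n.+1%:R * t) / sin t.
Proof.
move=> s0; apply: (canRL (mulfK s0)).
elim/ltn_ind: n => -[_|[_|n IH]].
- by rewrite /= hornerC !mul1r.
- have -> : 2%:R * t = t + t by ring.
  by rewrite /= hornerM hornerC hornerX sinD; ring.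
rewrite chebyshevUSS !(hornerE, hornerM) mulrBl -[_ * sin t in X in X - _]mulrA.
rewrite IH// IH//.
have -> : n.+3%:R * t = n.+2%:R * t + t by rewrite -[n.+3%:R]natr1; ring.
have -> : n.+1%:R * t = n.+2%:R * t - t by rewrite -[n.+2%:R]natr1; ring.
by rewrite sinB sinD; ring.
Qed.

Lemma smallest_positive_root_exists (R : realType) (p : {poly R}) (x : R) :
  p != 0 -> 0 < x -> root p x -> smallest_positive_root p !=set0.
Proof.
move=> p0 x0 px.
have xr : x \in roots p 0 (x + 1).
  by rewrite in_roots px p0 in_itv/= x0 ltrDl ltr01.
have rE y : (y \in roots p 0 (x + 1)) = (root p y && (0 < y < x + 1)).
  by rewrite in_roots p0 andbT in_itv.
have := sorted_roots 0 (x + 1) p.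
case E : (roots p 0 (x + 1)) xr => [//|y s] _ /=.
move=> /(order_path_min lt_trans)/allP ys.
have /andP[py /andP[y0 yx]] : root p y && (0 < y < x + 1).
  by rewrite -rE E mem_head.
exists y; split => // z z0 pz.
have [zx|/(lt_le_trans yx)/ltW//] := ltP z (x + 1).
have : z \in roots p 0 (x + 1) by rewrite rE pz z0.
by rewrite E in_cons => /predU1P[->//|/ys/ltW].
Qed.

Lemma chebyshevU1 (R : realType) (n : nat) : (chebyshevU R n).[1] = n.+1%:R.
Proof.
elim/ltn_ind: n => -[_|[_|n IH]].
- by rewrite /= hornerC.
- by rewrite /= hornerM hornerC hornerX mulr1.
rewrite chebyshevUSS !(hornerE, hornerM) IH// IH//.
by rewrite -[n.+3%:R]natr1 -[n.+2%:R]natr1; ring.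
Qed.

Lemma nuP (R : realType) (N : nat) : (2 <= N)%N ->
  smallest_positive_root (chebyshevU R N.+2)^`() (nu R N).
Proof.
move=> N2; rewrite /nu.
set U := chebyshevU R N.+2.
suff [x Sx] : smallest_positive_root U^`() !=set0 by apply: (xgetI _ Sx).
have pi0 : 0 < pi :> R := pi_gt0 R.
pose d : R := N.+3%:R.
have d5 : 5%:R <= d by rewrite ler_nat !ltnS.
pose th : R := pi / d.
have thd : th * d = pi by rewrite /th divfK//; apply/eqP; lra.
have th0 : 0 < th by rewrite divr_gt0//; lra.
have th5 : 5%:R * th <= pi by rewrite -thd mulrC ler_wpM2l// ltW.
have rU (k : nat) : 0 < k%:R * th < pi -> U.[cos (k%:R * th)] = 0.
  move=> kth; rewrite chebyshevU_cos; last by rewrite gt_eqF// sin_gt0_pi.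
  have -> : N.+3%:R * (k%:R * th) = 0 + pi *+ k.
    by rewrite -[pi *+ k]mulr_natl -thd /d; ring.
  by rewrite (alternatingn (@sinDpi R)) sin0 mulr0 mul0r.
have r1 := rU 1%N ltac:(apply/andP; split; lra).
have r2 := rU 2%N ltac:(apply/andP; split; lra).
have lt21 : cos (2%:R * th) < cos (1%:R * th).
  by rewrite ltr_cos ?in_itv/=; [lra| apply/andP; split; lra..].
have [c /itvP ci Uc] := poly_rolle lt21 (etrans r2 (esym r1)).
have c0 : 0 < c.
  apply: (@lt_trans _ _ (cos (2%:R * th))); last by rewrite ci.
  by rewrite cos_gt0_pihalf//; apply/andP; split; lra.
apply: (@smallest_positive_root_exists _ _ c) => //; last by apply/rootP.
apply/eqP => U'0.
have cos1 : cos (1%:R * th) < 1.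
  by rewrite -[ltRHS](cos0 R) ltr_cos ?in_itv/=; [lra| apply/andP; split; lra..].
have [e _] := poly_mvt U cos1.
rewrite U'0 hornerC mul0r r1 chebyshevU1 subr0 => /eqP.
by rewrite pnatr_eq0.
Qed.

(* Main.v *)
Require Import Defs.
From mathcomp Require Import all_boot all_order all_algebra.
From mathcomp Require Import all_classical all_reals all_analysis.
From mathcomp Require Import ring lra zify complex polyrcf.

(** A polynomial [p = a_1 X + ... + a_N X ^ N] satisfies
    [Im p (exp (i t)) = sin t * q (cos t)], where [q] is the sum of the
    [a_(j+1) U_j] for [j < N], its Chebyshev transform. By the minimum principle
    for the harmonic function [Im p] on the upper half disk, [p] with [a_1 = 1] is
    typically real exactly when [q >= 0] on [[-1, 1]]
    ([typically_real_transform_ge0], [radial_transform_gt0]).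

    Let [L] be the linear functional for which the [U_j] are orthonormal. Then
    [a_1 = L q] and [a_2 = L (U_1 q) = L (2 X q)], and the problem becomes to
    maximize [L (2 X q)] over the polynomials [q] of degree less than [N] that are
    nonnegative on [[-1, 1]] and satisfy [L q = 1]. Take a quadrature rule for [L]
    that has positive weights [w x] at nodes [x], is exact up to degree [N], and
    has largest node [mu]. Then [2 mu - L (2 X q)] is twice the sum of the
    [w x * (mu - x) * q x], so that [a_2 <= 2 mu], with equality exactly when [q]
    vanishes at all nodes but [mu]. Being nonnegative, [q] vanishes doubly at the
    inner nodes, and its degree leaves only one normalized possibility
    ([gauss_quadrature], [gauss_extremalP]).

    For odd [N] the nodes are the roots of [U_((N+1)/2)], and
    [mu = cos (2 pi / (N + 3))]. For even [N] one needs the Gauss-Radau rule with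
    an additional node at [-1]; its inner nodes are the numbers [1 - 2 c ^ 2],
    where [c] runs over the positive roots of [U'_(N+2)] ([radau_poly_deriv]), so
    that the largest one comes from the smallest [c]. The bound from below and its
    extremal polynomial follow by the reflection that sends [p] to
    [- p (- X)]. *)

Set Implicit Arguments.
Unset Strict Implicit.
Unset Printing Implicit Defensive.

Import Order.TTheory GRing.Theory Num.Theory.
Import numFieldNormedType.Exports.
Local Open Scope ring_scope.

(** * Chebyshev polynomials of the second kind *)

Section ChebyshevPolynomials.
Variable R : realType.
Local Notation U := (chebyshevU R).

Lemma size_lead_coef_chebyshevU n :
  size (U n) = n.+1 /\ lead_coef (U n) = 2 ^+ n.
Proof.
elim/ltn_ind: n => -[_|[_|n IH]].
- by rewrite /= size_poly1 lead_coef1 expr0.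
- by rewrite /= mul_polyC lead_coefZ size_scale ?pnatr_eq0// size_polyX
    lead_coefX mulr1 expr1.
have [s1 l1] := IH n.+1 (leqnn _).
have [s0 _] := IH n (leqW (leqnn _)).
rewrite chebyshevUSS.
have c2 : 2 != 0 :> R by rewrite pnatr_eq0.
have sX : size (2%:P * 'X * U n.+1) = n.+3.
  rewrite -mulrA mul_polyC size_scale// mulrC size_mulX ?s1//.
  by rewrite -size_poly_eq0 s1.
have lt : (size (- U n)%R < size (2%:P * 'X * U n.+1)%R)%N.
  by rewrite size_polyN s0 sX.
rewrite size_polyDl// sX lead_coefDl//; split=> //.
by rewrite -mulrA mul_polyC lead_coefZ lead_coefM lead_coefX l1 mul1r -exprS.
Qed.

Lemma size_chebyshevU n : size (U n) = n.+1.
Proof. exact: (size_lead_coef_chebyshevU n).1. Qed.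

Lemma chebyshevUN1 n : (U n).[-1] = (-1) ^+ n * n.+1%:R.
Proof.
elim/ltn_ind: n => -[_|[_|n IH]].
- by rewrite /= hornerC mulr1.
- by rewrite /= hornerM hornerC hornerX; ring.
rewrite chebyshevUSS !(hornerE, hornerM) IH// IH//.
by rewrite -[n.+3%:R]natr1 -[n.+2%:R]natr1 !exprS; ring.
Qed.

Lemma sin_chebyshevU n (t : R) : (U n).[cos t] * sin t = sin (n.+1%:R * t).
Proof.
elim/ltn_ind: n => -[_|[_|n IH]].
- by rewrite /= hornerC !mul1r.
- have -> : 2%:R * t = t + t by ring.
  by rewrite /= hornerM hornerC hornerX sinD; ring.
rewrite chebyshevUSS !(hornerE, hornerM) mulrBl -[_ * sin t in X in X - _]mulrA.
rewrite IH// IH//.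
have -> : n.+3%:R * t = n.+2%:R * t + t by rewrite -[n.+3%:R]natr1; ring.
have -> : n.+1%:R * t = n.+2%:R * t - t by rewrite -[n.+2%:R]natr1; ring.
by rewrite sinB sinD; ring.
Qed.

Definition equi_angle n k : R := k%:R * pi / n%:R.

Lemma equi_angle_itv n k : (0 < k < n)%N -> 0 < equi_angle n k < pi.
Proof.
move=> /andP[k0 kn]; have pi0 := pi_gt0 R.
have n0 : (0 < n)%N := leq_ltn_trans (leq0n k) kn.
rewrite divr_gt0 ?mulr_gt0 ?ltr0n//=.
by rewrite ltr_pdivrMr ?ltr0n// mulrC ltr_pM2l// ltr_nat.
Qed.

Lemma ler_cos_equi_angle n j k : (0 < j < n)%N -> (0 < k < n)%N ->
  (cos (equi_angle n k) <= cos (equi_angle n j)) = (j <= k)%N.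
Proof.
move=> jI kI; have /andP[j0 j1] := equi_angle_itv jI.
have /andP[k0 k1] := equi_angle_itv kI.
rewrite leNgt ltr_cos ?in_itv/= ?ltW// -leNgt.
rewrite /equi_angle ler_pM2r ?invr_gt0 ?ltr0n; last by lia.
by rewrite ler_pM2r ?pi_gt0// ler_nat.
Qed.

Lemma cos_equi_angle_inj n j k : (0 < j < n)%N -> (0 < k < n)%N ->
  cos (equi_angle n j) = cos (equi_angle n k) -> j = k.
Proof.
move=> jI kI E; apply/eqP.
rewrite eqn_leq -(ler_cos_equi_angle jI kI) -(ler_cos_equi_angle kI jI).
by rewrite E lexx.
Qed.

Lemma root_chebyshevU n k : (0 < k < n.+1)%N ->
  root (U n) (cos (equi_angle n.+1 k)).
Proof.
move=> kI; have /andP[t0 t1] := equi_angle_itv kI.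
have : (U n).[cos (equi_angle n.+1 k)] * sin (equi_angle n.+1 k) = 0.
  rewrite sin_chebyshevU.
  have -> : n.+1%:R * equi_angle n.+1 k = 0 + pi *+ k.
    by rewrite /equi_angle -mulr_natl; field; rewrite gt_eqF ?ltr0n.
  by rewrite (alternatingn (@sinDpi R)) sin0 mulr0.
move=> /eqP; rewrite mulf_eq0 [sin _ == 0]gt_eqF ?sin_gt0_pi ?t0//.
by rewrite orbF.
Qed.

Lemma chebyshev_expansion n (q : {poly R}) : (size q <= n)%N ->
  exists c : nat -> R, q = \sum_(j < n) c j *: U j.
Proof.
elim: n q => [|n IH] q sq.
  by exists (fun=> 0); rewrite big_ord0; apply/eqP; rewrite -size_poly_leq0.
have [sU lU] := size_lead_coef_chebyshevU n.
have U0 : 2 ^+ n != 0 :> R by rewrite expf_neq0 ?pnatr_eq0.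
have Un : (U n)`_n = 2 ^+ n by rewrite -lU lead_coefE sU.
have [|c cE] := IH (q - (q`_n / 2 ^+ n) *: U n).
  apply/leq_sizeP => j; rewrite leq_eqVlt => /predU1P[<-|nj].
    by rewrite coefB coefZ Un divfK ?subrr.
  rewrite coefB coefZ (nth_default _ (leq_trans sq nj)).
  by rewrite [(U n)`_j]nth_default ?sU// mulr0 subrr.
exists (fun j => if j == n then q`_n / 2 ^+ n else c j).
rewrite big_ord_recr/= eqxx -[LHS](subrK ((q`_n / 2 ^+ n) *: U n)) cE.
by congr (_ + _); apply: eq_bigr => j _; rewrite ltn_eqF.
Qed.

Lemma size_chebyshev_sum n (c : nat -> R) :
  (size (\sum_(j < n) c j *: U j)%R <= n)%N.
Proof.
apply: (leq_trans (size_sum _ _ _)); apply/bigmax_leqP => j _.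
by apply: (leq_trans (size_scale_leq _ _)); rewrite size_chebyshevU.
Qed.

End ChebyshevPolynomials.

(** * A positive functional with orthonormal Chebyshev polynomials *)

Section ChebyshevFunctional.
Variable R : realType.
Local Notation U := (chebyshevU R).

(** The trapezoidal sum in [t], where [x = cos t], of the integral of [f] against
    the weight [2 / pi * sqrt (1 - x ^ 2)] for which the polynomials [U_j] are
    orthonormal. It is exact below degree [2 n - 2], and with a sum the
    positivity of the functional needs no integration theory. *)
Definition cheb_functional n (f : {poly R}) : R :=
  2 / n%:R * \sum_(k < n) sin (equi_angle R n k) ^+ 2 *
    f.[cos (equi_angle R n k)].
Local Notation L := cheb_functional.

Lemma cheb_functional_linear n (a : R) (f g : {poly R}) :
  L n (a *: f + g) = a * L n f + L n g.
Proof.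
rewrite /L mulrCA -mulrDr; congr (_ * _).
rewrite mulr_sumr -big_split/=; apply: eq_bigr => k _.
by rewrite hornerD hornerZ; ring.
Qed.

Lemma cheb_functional0 n : L n 0 = 0.
Proof. by rewrite /L big1 ?mulr0// => k _; rewrite horner0 mulr0. Qed.

Lemma cheb_functionalZ n a f : L n (a *: f) = a * L n f.
Proof.
by rewrite -[a *: f]addr0 cheb_functional_linear cheb_functional0 addr0.
Qed.

Lemma cheb_functionalD n f g : L n (f + g) = L n f + L n g.
Proof. by rewrite -[f]scale1r cheb_functional_linear mul1r scale1r. Qed.

Lemma cheb_functional_sum n (I : Type) (r : seq I) (a : I -> R)
    (f : I -> {poly R}) :
  L n (\sum_(i <- r) a i *: f i) = \sum_(i <- r) a i * L n (f i).
Proof.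
elim: r => [|i r IH]; first by rewrite !big_nil cheb_functional0.
by rewrite !big_cons cheb_functional_linear IH.
Qed.

(** Multiplied by [2 * sin (l * pi / (2 * n))] the sum telescopes. *)
Lemma sum_cos_equidistant n l : (0 < l < n.*2)%N ->
  \sum_(k < n) cos (l%:R * equi_angle R n k) = (odd l)%:R :> R.
Proof.
move=> /andP[l0 ln].
have n0 : (0 < n)%N by rewrite -double_gt0 (leq_ltn_trans _ ln).
have nR : n%:R != 0 :> R by rewrite pnatr_eq0 -lt0n.
have nR0 : 0 < n%:R :> R by rewrite ltr0n.
pose phi : R := l%:R * pi / (2 * n%:R).
have phiE : 2 * n%:R * phi = l%:R * pi by rewrite /phi; field.
have pi0 := pi_gt0 R.
have s0 : 0 < sin phi.
  apply: sin_gt0_pi; apply/andP; split.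
    by rewrite divr_gt0 ?mulr_gt0 ?ltr0n.
  rewrite ltr_pdivrMr ?mulr_gt0// mulrC ltr_pM2l//.
  by rewrite -natrM ltr_nat mul2n.
have tele : 2 * sin phi *
    \sum_(k < n) cos (l%:R * equi_angle R n k) =
    sin ((2 * n%:R - 1) * phi) + sin phi.
  have E (k : nat) : 2 * sin phi * cos (l%:R * equi_angle R n k) =
      sin ((2 * k.+1%:R - 1) * phi) - sin ((2 * k%:R - 1) * phi).
    have -> : l%:R * equi_angle R n k = 2 * k%:R * phi.
      by rewrite /phi /equi_angle; field.
    have -> : (2 * k.+1%:R - 1) * phi = 2 * k%:R * phi + phi.
      by rewrite -natr1; ring.
    have -> : (2 * k%:R - 1) * phi = 2 * k%:R * phi - phi by ring.
    by rewrite sinB sinD; ring.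
  rewrite mulr_sumr; under eq_bigr do rewrite E.
  rewrite -(big_mkord xpredT
    (fun k => sin ((2 * k.+1%:R - 1) * phi) - sin ((2 * k%:R - 1) * phi))).
  rewrite (telescope_sumr (fun k => sin ((2 * k%:R - 1) * phi)))//.
  by rewrite mulr0 sub0r mulN1r sinN opprK.
have sE : sin ((2 * n%:R - 1) * phi) = - (-1) ^+ l * sin phi.
  have -> : (2 * n%:R - 1) * phi = - phi + pi *+ l.
    by rewrite mulrBl phiE mulr_natl; ring.
  by rewrite (alternatingn (@sinDpi R)) sinN; ring.
have : 2 * sin phi * \sum_(k < n) cos (l%:R * equi_angle R n k) =
    2 * sin phi * (odd l)%:R.
  by rewrite tele sE -signr_odd; case: (odd l); rewrite /= ?expr1 ?expr0; ring.
by apply: mulfI; rewrite mulf_neq0 ?pnatr_eq0// gt_eqF.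
Qed.

(** The product formula for sines turns the sum into the difference of two sums
    of [sum_cos_equidistant], at indices of the same parity. *)
Lemma cheb_functional_orthonormal n j k : (j + k + 2 < n.*2)%N ->
  L n (U j * U k) = (j == k)%:R.
Proof.
wlog jk : j k / (k <= j)%N => [hw jkn|].
  have [/hw|/ltnW/hw] := leqP k j; first exact.
  by rewrite mulrC eq_sym; apply; rewrite [(k + j)%N]addnC.
move=> jkn.
have n0 : (0 < n)%N by lia.
have nR : n%:R != 0 :> R by rewrite pnatr_eq0 -lt0n.
have E (i : nat) : sin (equi_angle R n i) ^+ 2 *
    (U j * U k).[cos (equi_angle R n i)] =
    (cos ((j - k)%:R * equi_angle R n i) -
     cos ((j + k + 2)%:R * equi_angle R n i)) / 2.
  set t := equi_angle R n i.
  rewrite hornerM.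
  have -> : sin t ^+ 2 * ((U j).[cos t] * (U k).[cos t]) =
    ((U j).[cos t] * sin t) * ((U k).[cos t] * sin t) by ring.
  rewrite !sin_chebyshevU.
  have -> : (j - k)%:R * t = j.+1%:R * t - k.+1%:R * t.
    by rewrite natrB// -[j.+1%:R]natr1 -[k.+1%:R]natr1; ring.
  have -> : (j + k + 2)%:R * t = j.+1%:R * t + k.+1%:R * t.
    by rewrite !natrD -[j.+1%:R]natr1 -[k.+1%:R]natr1; ring.
  by rewrite cosB cosD; field.
rewrite /L; under eq_bigr do rewrite E.
rewrite -mulr_suml sumrB.
rewrite [X in _ - X]sum_cos_equidistant; last by rewrite jkn addnS.
have [<-|njk] := eqVneq.
  rewrite subnn (eq_bigr (fun=> 1)); last by move=> i _; rewrite mul0r cos0.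
  rewrite sumr_const card_ord !oddD addbb/=.
  by field.
rewrite sum_cos_equidistant; last by lia.
by rewrite oddD oddB// addbF oddD subrr mul0r mulr0.
Qed.

Lemma cheb_functional_coef n m (c : nat -> R) i :
  (i < m)%N -> (i + m + 1 < n.*2)%N ->
  L n (U i * \sum_(j < m) c j *: U j) = c i.
Proof.
move=> im imn.
rewrite mulr_sumr (eq_bigr (fun j : 'I_m => c j *: (U i * U j))); last first.
  by move=> j _; rewrite scalerAr.
rewrite cheb_functional_sum (bigD1 (Ordinal im))//=.
rewrite cheb_functional_orthonormal ?eqxx ?mulr1; last by lia.
rewrite big1 ?addr0// => j ji.
rewrite cheb_functional_orthonormal; last by have := ltn_ord j; lia.
case: eqP => [ij|]; last by rewrite mulr0.
by case/eqP: ji; apply/val_inj.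
Qed.

Lemma cheb_functional_orthogonal n m (g : {poly R}) :
  (size g <= m)%N -> (m.*2 + 1 < n.*2)%N -> L n (U m * g) = 0.
Proof.
move=> /chebyshev_expansion[c ->] mn.
rewrite mulr_sumr (eq_bigr (fun j : 'I_m => c j *: (U m * U j))); last first.
  by move=> j _; rewrite scalerAr.
rewrite cheb_functional_sum big1// => j _; have jm := ltn_ord j.
rewrite cheb_functional_orthonormal; last by lia.
by rewrite gtn_eqF ?mulr0.
Qed.

(** Vanishing of the sum would give [f] more roots, at the [n - 1] nodes in the
    open interval, than its degree allows. *)
Lemma cheb_functional_gt0 n (f : {poly R}) :
  f != 0 -> (size f < n)%N -> (forall x, -1 <= x <= 1 -> 0 <= f.[x]) ->
  0 < L n f.
Proof.
move=> f0 sf fpos.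
have n0 : (0 < n)%N by lia.
have nR0 : 0 < n%:R :> R by rewrite ltr0n.
pose T := equi_angle R n.
have pos k : 0 <= sin (T k) ^+ 2 * f.[cos (T k)].
  by rewrite mulr_ge0 ?sqr_ge0// fpos// cos_geN1 cos_le1.
rewrite mulr_gt0 ?divr_gt0// lt_def andbC sumr_ge0/=; last first.
  by move=> k _; apply: pos.
apply: contra_neq f0 => /psumr_eq0P z.
have rk k : (0 < k < n)%N -> root f (cos (T k)).
  move=> kn; have /andP[_ kn'] := kn.
  have /eqP := z (fun i _ => pos i) (Ordinal kn') isT.
  by rewrite /= mulf_eq0 sqrf_eq0 gt_eqF ?sin_gt0_pi ?equi_angle_itv.
apply: (@roots_geq_poly_eq0 _ f [seq cos (T k) | k <- iota 1 n.-1]).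
- by apply/allP => _ /mapP[k + ->]; rewrite mem_iota => ?; apply: rk; lia.
- rewrite map_inj_in_uniq ?iota_uniq// => j k; rewrite !mem_iota => hj hk cE.
  by apply: cos_equi_angle_inj cE; lia.
- by rewrite size_map size_iota -ltnS prednK.
Qed.

End ChebyshevFunctional.

(** * Nonnegative polynomials with prescribed zeros *)

Section NodeFactor.
Variable R : realType.
Implicit Types (y : R) (q : {poly R}) (s : seq R).

Definition nonneg_on_itv q := forall x, -1 <= x <= 1 -> 0 <= q.[x].

(** The least order to which a polynomial that is nonnegative on the interval can
    vanish at [y < 1]: only at the endpoint may a zero be simple. *)
Definition node_mult y : nat := if y == -1 then 1 else 2.

Definition node_factor y : {poly R} := ('X - y%:P) ^+ node_mult y.

Definition node_prod s : {poly R} := \prod_(y <- s) node_factor y.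

Lemma size_node_factor y : size (node_factor y) = (node_mult y).+1.
Proof. by rewrite size_exp_XsubC. Qed.

Lemma monic_node_prod s : node_prod s \is monic.
Proof. by apply: monic_prod => y _; rewrite monic_exp// monicXsubC. Qed.

Lemma size_node_prod s :
  size (node_prod s) = (\sum_(y <- s) node_mult y)%N.+1.
Proof.
elim: s => [|y s IH]; first by rewrite /node_prod !big_nil size_poly1.
rewrite /node_prod !big_cons size_Mmonic ?monic_node_prod//.
  by rewrite [X in (_ + X)%N]IH size_node_factor addnS addSn.
by rewrite -size_poly_eq0 size_node_factor.
Qed.

Lemma nonneg_node_prod s : nonneg_on_itv (node_prod s).
Proof.
move=> x /andP[x1 _]; rewrite horner_prod; apply: prodr_ge0 => y _.
rewrite /node_factor /node_mult horner_exp hornerXsubC.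
case: eqP => [->|_]; last exact: sqr_ge0.
by rewrite expr1; lra.
Qed.

Lemma root_node_prod s x : root (node_prod s) x = (x \in s).
Proof.
rewrite -[x \in s]root_prod_XsubC /node_prod.
elim: s => [|y s IH]; first by rewrite !big_nil.
rewrite !big_cons !rootM IH /node_factor /node_mult.
by case: eqP => _; rewrite ?expr1 ?expr2 ?rootM ?orbb.
Qed.

(** A zero inside the interval is double, because [q] would change sign at a
    simple one. *)
Lemma node_factor_dvdp y q :
  -1 <= y < 1 -> nonneg_on_itv q -> root q y -> node_factor y %| q.
Proof.
move=> /andP[y1 y2] q0 qy; rewrite /node_factor /node_mult.
have [_|yN1] := eqVneq; first by rewrite expr1 dvdp_XsubCl.
move: (qy); rewrite -dvdp_XsubCl => /dvdpP[g qE].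
rewrite qE expr2 dvdp_mul2r ?polyXsubC_eq0// dvdp_XsubCl.
have yl : -1 < y by rewrite lt_def yN1.
have qx x : q.[x] = g.[x] * (x - y) by rewrite qE hornerM hornerXsubC.
have cg : {for y, continuous (horner g)} by apply: continuous_horner.
apply/rootP; apply/eqP; rewrite eq_le; apply/andP; split; rewrite leNgt;
  apply/negP => gy.
- have /(@nbhs_ballP R R)[e /= e0 he] : \forall x \near y, 0 < g.[x].
    exact: (cvgr_gt _ cg).
  pose x := Num.max (-1) (y - e / 2).
  have xy : x < y by rewrite gt_max yl/=; lra.
  have xl : y - e / 2 <= x by rewrite le_max lexx orbT.
  have x1 : -1 <= x by rewrite le_max lexx.
  have gx : 0 < g.[x].
    by apply: he; rewrite /ball/= ger0_norm; lra.
  have : 0 <= q.[x] by apply: q0; apply/andP; split; lra.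
  by rewrite qx pmulr_rge0// subr_ge0 leNgt xy.
- have /(@nbhs_ballP R R)[e /= e0 he] : \forall x \near y, g.[x] < 0.
    exact: (cvgr_lt _ cg).
  pose x := Num.min 1 (y + e / 2).
  have xy : y < x by rewrite lt_min y2/=; lra.
  have xl : x <= y + e / 2 by rewrite ge_min lexx orbT.
  have x1 : x <= 1 by rewrite ge_min lexx.
  have gx : g.[x] < 0.
    by apply: he; rewrite /ball/= ler0_norm; lra.
  have : 0 <= q.[x] by apply: q0; apply/andP; split; lra.
  by rewrite qx nmulr_rge0// subr_le0 leNgt xy.
Qed.

Lemma node_prod_dvdp s q :
  uniq s -> (forall y, y \in s -> -1 <= y < 1) -> nonneg_on_itv q ->
  all (root q) s -> node_prod s %| q.
Proof.
move=> us sI q0; elim: s us sI => [|y s IH].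
  by rewrite /node_prod big_nil dvd1p.
move=> /= /andP[ys us] sI /andP[qy qs].
rewrite /node_prod big_cons Gauss_dvdp.
  rewrite node_factor_dvdp ?sI ?mem_head//=.
  by apply: IH => // z zs; rewrite sI// in_cons zs orbT.
rewrite coprimep_expl// coprimep_sym coprimep_XsubC.
by rewrite root_node_prod.
Qed.

End NodeFactor.

(** * Quadrature and the extremal problem *)

Section GaussQuadrature.
Variables (R : realType) (n N : nat) (s : seq R).
Hypothesis Nn : (N.+1 < n)%N.
Hypothesis us : uniq s.
Hypothesis sI : forall y, y \in s -> -1 <= y < 1.
(* By this count [node_prod s] has degree [N + 1], so that leaving out the node
   [mu], of multiplicity 2, gives a polynomial of degree exactly [N - 1]. *)
Hypothesis sN : (\sum_(y <- s) node_mult y)%N = N.+1.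
Local Notation L := (cheb_functional n).
Hypothesis orth : forall g : {poly R}, (size s + size g <= N.+1)%N ->
  L (\prod_(y <- s) ('X - y%:P) * g) = 0.

Let size_s : (size s <= N.+1)%N.
Proof.
rewrite -sN -sum1_size; apply: leq_sum => y _.
by rewrite /node_mult; case: ifP.
Qed.

Lemma size_node_prod_rem x : x \in s ->
  (size (node_prod (rem x s)) + node_mult x = N.+2)%N.
Proof.
move=> xs; rewrite size_node_prod addSn; congr _.+1.
by rewrite -sN (big_rem x xs)/= addnC.
Qed.

(** Exactness is Lagrange interpolation at the nodes: the remainder is a multiple
    of the node polynomial, on which the functional vanishes by orthogonality.
    The weight at [x] is positive because [node_prod (rem x s)] is a nonnegative
    polynomial, of degree at most [N], that vanishes at all the other nodes. *)
Lemma gauss_quadrature : exists w : R -> R,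
  (forall x, x \in s -> 0 < w x) /\
  (forall f : {poly R}, (size f <= N.+1)%N ->
    L f = \sum_(x <- s) w x * f.[x]).
Proof.
pose l x : {poly R} := \prod_(y <- rem x s) ('X - y%:P).
have lx0 x : x \in s -> (l x).[x] != 0.
  move=> xs; rewrite -[_ == 0]/(root _ _) root_prod_XsubC.
  by rewrite mem_rem_uniq// inE eqxx.
have lz x z : z \in s -> z != x -> (l x).[z] = 0.
  move=> zs zx; apply/rootP.
  by rewrite root_prod_XsubC mem_rem_uniq// inE zx zs.
have sumE (F : R -> R) z :
    z \in s -> (forall x, x != z -> x \in s -> F x = 0) ->
    \sum_(x <- s) F x = F z.
  move=> zs F0; rewrite (big_rem z zs)/= big_seq big1 ?addr0// => x.
  by rewrite mem_rem_uniq// inE => /andP[xz xs]; apply: F0.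
pose w x := L (l x) / (l x).[x].
have exact_w (f : {poly R}) : (size f <= N.+1)%N ->
    L f = \sum_(x <- s) w x * f.[x].
  move=> sf.
  pose p := \sum_(x <- s) (f.[x] / (l x).[x]) *: l x.
  have Lp : L p = \sum_(x <- s) w x * f.[x].
    by rewrite cheb_functional_sum; apply: eq_bigr => x _; rewrite /w; ring.
  have sp : (size p <= size s)%N.
    rewrite /p big_seq; apply: (leq_trans (size_sum _ _ _)).
    apply/bigmax_leqP_seq => x xs _; apply: (leq_trans (size_scale_leq _ _)).
    rewrite size_prod_XsubC size_rem// prednK//.
    by case: (s) xs.
  have rootr : all (root (f - p)) s.
    apply/allP => z zs; apply/rootP; rewrite hornerD hornerN horner_sum.
    rewrite (sumE (fun x => ((f.[x] / (l x).[x]) *: l x).[z]) z)//.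
      by rewrite hornerZ divfK ?subrr// lx0.
    by move=> x xz xs; rewrite hornerZ (lz x z) ?mulr0// eq_sym.
  have [g fE] := uniq_roots_prod_XsubC rootr
    (etrans (uniq_rootsE _) us).
  have : L (f - p) = 0.
    have [g0|g0] := eqVneq g 0.
      by rewrite fE g0 mul0r cheb_functional0.
    rewrite fE mulrC; apply: orth.
    have : (size (f - p)%R <= N.+1)%N.
      rewrite (leq_trans (size_polyD _ _))// size_polyN geq_max sf/=.
      exact: leq_trans sp size_s.
    rewrite fE size_Mmonic ?monic_prod_XsubC//.
    by rewrite size_prod_XsubC addnS/= addnC.
  rewrite -Lp -[- p]scaleN1r cheb_functionalD cheb_functionalZ mulN1r.
  by move/subr0_eq.
exists w; split=> // x xs.
have sh := size_node_prod_rem xs.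
have h0 : node_prod (rem x s) != 0 by apply/monic_neq0/monic_node_prod.
have shn : (size (node_prod (rem x s)) <= N.+1)%N.
  by move: sh; rewrite /node_mult; case: ifP => _; lia.
have := cheb_functional_gt0 h0 (leq_ltn_trans shn Nn) (@nonneg_node_prod _ _).
rewrite exact_w// (sumE (fun x0 => w x0 * _) x)//.
  rewrite pmulr_lgt0// lt_def -[_ == 0]/(root _ _) root_node_prod.
  rewrite mem_rem_uniq// inE eqxx/=; apply: nonneg_node_prod.
  by have /andP[-> /ltW] := sI xs.
move=> z zx zs; rewrite (rootP _) ?mulr0// root_node_prod.
by rewrite mem_rem_uniq// inE zx.
Qed.

Definition admissible (q : {poly R}) :=
  [/\ (size q <= N)%N, nonneg_on_itv q & L q = 1].

Variable mu : R.
Hypothesis mus : mu \in s.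
Hypothesis muN1 : -1 < mu.
Hypothesis mu_max : forall y, y \in s -> y <= mu.

Definition gauss_extremal : {poly R} :=
  (L (node_prod (rem mu s)))^-1 *: node_prod (rem mu s).

Let size_h : size (node_prod (rem mu s)) = N.
Proof.
have := size_node_prod_rem mus; rewrite /node_mult gt_eqF//.
by rewrite addn2 => -[].
Qed.

Let h0 : node_prod (rem mu s) != 0.
Proof. exact/monic_neq0/monic_node_prod. Qed.

Let Lh : 0 < L (node_prod (rem mu s)).
Proof.
apply: cheb_functional_gt0 => //; last exact: nonneg_node_prod.
by rewrite size_h ltnW.
Qed.

Let LU1 (q : {poly R}) :
  L (chebyshevU R 1 * q) = 2 * mu * L q - 2 * L ((mu%:P - 'X) * q).
Proof.
have -> : chebyshevU R 1 * q = (2 * mu) *: q + (- 2) *: ((mu%:P - 'X) * q).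
  by rewrite /= -!mul_polyC polyCN polyCM; ring.
by rewrite cheb_functional_linear cheb_functionalZ; ring.
Qed.

(** The quadrature rule writes [L ((mu - X) q)] as the sum of the
    [w x * (mu - x) * q.[x]], with nonnegative terms. It vanishes only if [q]
    does at every node other than [mu]; then [node_prod (rem mu s)] divides [q],
    and it has the largest degree allowed for [q]. *)
Lemma gauss_extremalP :
  [/\ forall q, admissible q -> L (chebyshevU R 1 * q) <= 2 * mu,
      forall q, admissible q -> L (chebyshevU R 1 * q) = 2 * mu ->
        q = gauss_extremal,
      admissible gauss_extremal &
      L (chebyshevU R 1 * gauss_extremal) = 2 * mu].
Proof.
have [w [w0 wE]] := gauss_quadrature.
have sq (q : {poly R}) : (size q <= N)%N ->
    (size ((mu%:P - 'X) * q)%R <= N.+1)%N.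
  move=> sq; rewrite -opprB mulNr size_polyN mulrC.
  have [->|q0] := eqVneq q 0; first by rewrite mul0r size_poly0.
  by rewrite size_Mmonic ?monicXsubC// size_XsubC addn2.
have LX (q : {poly R}) : (size q <= N)%N ->
    L ((mu%:P - 'X) * q) = \sum_(x <- s) w x * ((mu - x) * q.[x]).
  move=> /sq/wE ->; apply: eq_bigr => x _.
  by rewrite hornerM hornerD hornerN hornerC hornerX.
have pos (q : {poly R}) x : nonneg_on_itv q -> x \in s ->
    0 <= w x * ((mu - x) * q.[x]).
  move=> q0 xs; have /andP[x1 /ltW x2] := sI xs.
  by rewrite !mulr_ge0 ?subr_ge0 ?mu_max// ?q0 ?x1// ltW ?w0.
split.
- move=> q [sqN q0 Lq]; rewrite LU1 Lq mulr1 LX// gerBl.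
  by rewrite mulr_ge0// big_seq sumr_ge0// => x xs; apply: pos.
- move=> q [sqN q0 Lq]; rewrite LU1 Lq mulr1 => LqE.
  have : L ((mu%:P - 'X) * q) = 0 by lra.
  rewrite LX// big_seq => /eqP; rewrite psumr_eq0; last by move=> x; apply: pos.
  move=> /allP z.
  have dv : node_prod (rem mu s) %| q.
    apply: node_prod_dvdp => //.
    - exact: rem_uniq.
    - by move=> y /mem_rem; apply: sI.
    apply/allP => y; rewrite mem_rem_uniq// inE => /andP[ymu ys].
    have := z y ys; rewrite ys/= !mulf_eq0 gt_eqF ?w0//= subr_eq0 eq_sym.
    by rewrite (negPf ymu).
  have q0' : q != 0.
    by apply: contra_eq_neq Lq => ->; rewrite cheb_functional0 eq_sym oner_neq0.
  have /eqpP[[a b] /= /andP[a0 b0] abE] : node_prod (rem mu s) %= q.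
    by rewrite -dvdp_size_eqp// eqn_leq size_h sqN -size_h dvdp_leq.
  have qE : q = (a / b) *: node_prod (rem mu s).
    by rewrite mulrC -scalerA abE scalerA mulVf// scale1r.
  rewrite /gauss_extremal qE; congr (_ *: _).
  move: Lq; rewrite qE cheb_functionalZ => /(canRL (mulfK (lt0r_neq0 Lh))) ->.
  by rewrite mul1r.
- split.
  + by rewrite size_scale ?invr_neq0 ?lt0r_neq0// size_h.
  + move=> x xI; rewrite hornerZ mulr_ge0 ?invr_ge0 ?(ltW Lh)//.
    exact: nonneg_node_prod.
  + by rewrite cheb_functionalZ mulVf ?lt0r_neq0.
rewrite LU1 cheb_functionalZ mulVf ?lt0r_neq0// mulr1 LX; last first.
  by rewrite size_scale ?invr_neq0 ?lt0r_neq0// size_h.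
rewrite big_seq big1 ?mulr0 ?subr0// => x xs.
have [->|xmu] := eqVneq x mu; first by rewrite subrr mul0r mulr0.
rewrite hornerZ (rootP _) ?mulr0// root_node_prod.
by rewrite mem_rem_uniq// inE xmu.
Qed.

End GaussQuadrature.

(** * The nodes for odd and even degree bound *)

Section Nodes.
Variable R : realType.
Local Notation U := (chebyshevU R).

Lemma chebyshevU_deriv n :
  (1 - 'X^2) * (U n)^`() = n.+2%:R *: ('X * U n) - n.+1%:R *: U n.+1.
Proof.
elim/ltn_ind: n => -[_|[_|n IH]].
- by rewrite /= -[1 in X in X = _]polyC1 derivC -!mul_polyC; ring.
- rewrite chebyshevUSS /= derivM derivC derivX mul0r add0r mulr1.
  by rewrite -!mul_polyC; ring.
have I1 := IH n.+1 (leqnn _); have I0 := IH n (leqW (leqnn _)).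
rewrite [in LHS]chebyshevUSS derivB !derivM derivC derivX mul0r add0r.
rewrite mulr1.
rewrite mulrBr mulrDr (mulrCA (1 - 'X^2)) I0.
have -> : (1 - 'X^2) * (2%:P * 'X * (U n.+1)^`()) =
  2%:P * 'X * ((1 - 'X^2) * (U n.+1)^`()) by ring.
rewrite I1 !chebyshevUSS -!mul_polyC -[n.+4%:R]natr1 -[n.+3%:R]natr1.
rewrite -[n.+2%:R]natr1 -[n.+1%:R]natr1.
by ring.
Qed.

Lemma prod_XsubC_orthogonal n N (s : seq R) (om : {poly R}) :
  uniq s -> all (root om) s -> size om = (size s).+1 ->
  (forall g : {poly R}, (size s + size g <= N)%N ->
    cheb_functional n (om * g) = 0) ->
  forall g : {poly R}, (size s + size g <= N)%N ->
    cheb_functional n (\prod_(y <- s) ('X - y%:P) * g) = 0.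
Proof.
move=> us rs som orth g /orth.
rewrite {1}(all_roots_prod_XsubC som rs (etrans (uniq_rootsE _) us)).
rewrite -scalerAl cheb_functionalZ => /eqP; rewrite mulf_eq0 lead_coef_eq0.
by rewrite -size_poly_eq0 som => /eqP.
Qed.

Definition is_gauss_rule N mu (s : seq R) :=
  [/\ uniq s, forall y, y \in s -> -1 <= y < 1,
      (\sum_(y <- s) node_mult y)%N = N.+1,
      forall g : {poly R}, (size s + size g <= N.+1)%N ->
        cheb_functional N.+3 (\prod_(y <- s) ('X - y%:P) * g) = 0 &
      [/\ mu \in s, -1 < mu & forall y, y \in s -> y <= mu]].

(** The Gauss rule: its nodes are the roots of [U_(m+1)], which is orthogonal to
    all polynomials of degree at most [m]. *)
Lemma gauss_rule_odd m :
  exists s, is_gauss_rule m.*2.+1 (cos (2 * pi / m.*2.+4%:R)) s.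
Proof.
pose T := equi_angle R m.+2.
have -> : 2 * pi / m.*2.+4%:R = T 1%N.
  rewrite /T /equi_angle -[m.*2.+4]/(m.+2.*2) -mul2n natrM.
  by field; have := ler0n R m; lra.
pose s := [seq cos (T k) | k <- iota 1 m.+1].
have sP y : y \in s -> exists2 k, (0 < k < m.+2)%N & y = cos (T k).
  by move=> /mapP[k]; rewrite mem_iota => kI ->; exists k => //; lia.
have sI y : y \in s -> -1 < y < 1.
  move=> /sP[k /(@equi_angle_itv R)/andP[? ?] ->].
  rewrite -[X in _ < _ < X](@cos0 R) -(@cospi R).
  by apply/andP; split; rewrite ltr_cos ?in_itv/= ?lexx ?ltW ?pi_gt0.
have us : uniq s.
  rewrite map_inj_in_uniq ?iota_uniq// => j k; rewrite !mem_iota => hj hk cE.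
  by apply: cos_equi_angle_inj cE; lia.
have ss : size s = m.+1 by rewrite size_map size_iota.
exists s; split=> //.
- by move=> y /sI/andP[/ltW -> ->].
- rewrite (eq_big_seq (fun=> 2%N)); last first.
    by move=> y /sI/andP[y1 _]; rewrite /node_mult gt_eqF.
  by rewrite big_const_seq count_predT iter_addn_0 ss; lia.
- apply: (@prod_XsubC_orthogonal _ _ _ (U m.+1)) => //.
  + by apply/allP => y /sP[k kI ->]; apply: root_chebyshevU.
  + by rewrite size_chebyshevU ss.
  + move=> g; rewrite ss => sg.
    by apply: cheb_functional_orthogonal; lia.
split.
- by apply/mapP; exists 1%N; rewrite ?mem_iota.
- by have /sI/andP[] : cos (T 1%N) \in s by apply/mapP; exists 1%N.
- by move=> _ /sP[k kI ->]; rewrite ler_cos_equi_angle//; lia.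
Qed.

(** The node polynomial of the Gauss-Radau rule with an endpoint node: the
    combination of [U_(m+2)] and [U_(m+1)] that vanishes at [-1], hence a multiple
    of [1 + X] that is still orthogonal to all polynomials of degree at most
    [m]. *)
Definition radau_poly m : {poly R} :=
  m.+2%:R *: U m.+2 + m.+3%:R *: U m.+1.

Lemma size_radau_poly m : size (radau_poly m) = m.+3.
Proof.
by rewrite size_polyDl !size_scale ?pnatr_eq0// !size_chebyshevU.
Qed.

(** Put [y = cos t], so that [1 - 2 y ^ 2 = cos u] with [u = pi - 2 t]. With
    [d = 2 m + 5], the Radau polynomial at [cos u] times [sin u] and
    [(1 - y ^ 2) * U'_(d-1) (y) * sin t] are, up to sign, both equal to
    [cos t * sin (d t) - d * sin t * cos (d t)]. *)
Lemma radau_poly_deriv m y : 0 < y < 1 ->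
  root (radau_poly m) (1 - 2 * y ^+ 2) = root (U m.*2.+4)^`() y.
Proof.
move=> /andP[y0 y1].
pose t := acos y; pose u : R := pi - t *+ 2.
have yI : -1 <= y <= 1 by apply/andP; split; lra.
have yE : cos t = y by rewrite acosK// in_itv.
have st : 0 < sin t.
  by rewrite sin_acos// sqrtr_gt0 subr_gt0 expr_lt1// ltW.
have cu : cos u = 1 - 2 * y ^+ 2.
  by rewrite /u addrC cosDpi cosN cos_mulr2n yE -mulr_natl; ring.
have su : sin u = 2 * y * sin t.
  by rewrite /u addrC sinDpi sinN opprK sin_mulr2n yE -mulr_natl; ring.
have mE : m.*2.+4%:R = 2 * m.+2%:R :> R by rewrite -natrM mul2n.
have m3E : m.+3%:R = m.+2%:R + 1 :> R by rewrite natr1.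
have m5E : m.*2.+4.+1%:R = 2 * m.+2%:R + 1 :> R by rewrite -mE natr1.
have m6E : m.*2.+4.+2%:R = 2 * m.+2%:R + 2 :> R.
  by rewrite -natr1 m5E; ring.
have key : (radau_poly m).[cos u] * sin u =
    - (-1) ^+ m * ((1 - y ^+ 2) * (U m.*2.+4)^`().[y] * sin t).
  have -> : (1 - y ^+ 2) * (U m.*2.+4)^`().[y] * sin t =
      m.*2.+4.+2%:R * (y * sin (m.*2.+4.+1%:R * t)) -
      m.*2.+4.+1%:R * sin (m.*2.+4.+2%:R * t).
    move: (chebyshevU_deriv m.*2.+4) (sin_chebyshevU m.*2.+4 t)
      (sin_chebyshevU m.*2.+4.+1 t).
    move: (U m.*2.+4) (U m.*2.+4.+1) => p q /(congr1 (horner^~ y))/=.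
    have -> : ((1 - 'X^2) * p^`()).[y] = (1 - y ^+ 2) * p^`().[y].
      by rewrite hornerM !hornerE.
    by rewrite hornerD hornerN !hornerZ hornerM hornerX yE => -> <- <-; ring.
  rewrite /radau_poly hornerD !hornerZ mulrDl -!mulrA !sin_chebyshevU.
  have e1 : m.+3%:R * u = - (m.*2.+4.+2%:R * t) + pi *+ m.+3.
    by rewrite /u -[pi *+ m.+3]mulr_natl m6E m3E; ring.
  have e2 : m.+2%:R * u = - (m.*2.+4%:R * t) + pi *+ m.+2.
    by rewrite /u -[pi *+ m.+2]mulr_natl mE; ring.
  rewrite e1 e2 !(alternatingn (@sinDpi R)) !sinN.
  have -> : m.*2.+4.+2%:R * t = m.*2.+4.+1%:R * t + t by rewrite m6E m5E; ring.
  have -> : m.*2.+4%:R * t = m.*2.+4.+1%:R * t - t by rewrite mE m5E; ring.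
  by rewrite sinD sinB yE !exprS m6E m5E m3E; ring.
have su0 : sin u != 0 by rewrite su !mulf_neq0 ?gt_eqF.
have y21 : 1 - y ^+ 2 != 0 by rewrite gt_eqF// subr_gt0 expr_lt1// ltW.
rewrite -cu !rootE; apply/idP/idP => /eqP E.
- move: key; rewrite E mul0r => /esym/eqP; rewrite !mulf_eq0 oppr_eq0.
  by rewrite signr_eq0 (negPf y21) (gt_eqF st) orbF.
- move: key; rewrite E mulr0 mul0r mulr0 => /eqP.
  by rewrite mulf_eq0 (negPf su0) orbF.
Qed.

(** Rolle's theorem between the [m + 2] positive roots of [U_(2m+4)] yields
    [m + 1] positive critical points [c], and with [-1] the numbers [1 - 2 c ^ 2]
    are as many roots of the Radau polynomial as its degree. The map
    [c |-> 1 - 2 c ^ 2] is decreasing, so that the smallest critical point gives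
    the largest node. *)
Lemma gauss_rule_even m :
  exists s, is_gauss_rule m.*2.+2 (1 - 2 * nu R m.*2.+2 ^+ 2) s.
Proof.
pose d := m.*2.+4.+1.
pose T := equi_angle R d.
have /choice[c cP] (k : nat) : exists x, (k < m.+1)%N ->
    [/\ cos (T k.+2) < x, x < cos (T k.+1) & root (U m.*2.+4)^`() x].
  have [km|km] := boolP (k < m.+1)%N; last by exists 0.
  have lt : cos (T k.+2) < cos (T k.+1).
    by rewrite ltNge ler_cos_equi_angle ?ltnn; rewrite /d; lia.
  have eq2 : (U m.*2.+4).[cos (T k.+2)] = (U m.*2.+4).[cos (T k.+1)].
    by rewrite !(rootP (root_chebyshevU _ _))//; rewrite /d; lia.
  have [x /itvP xI Ux] := poly_rolle lt eq2.
  by exists x => _; split; rewrite ?xI//; apply/rootP.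
have c01 k : (k < m.+1)%N -> 0 < c k < 1.
  move=> km; have [c1 c2 _] := cP k km; have pi0 := pi_gt0 R.
  have /(@equi_angle_itv R)/andP[? ?] : (0 < k.+1 < d)%N by rewrite /d; lia.
  have /(@equi_angle_itv R)/andP[t0 _] : (0 < k.+2 < d)%N by rewrite /d; lia.
  rewrite (lt_trans _ c1)/=.
    rewrite (lt_trans c2)// -[X in _ < X](@cos0 R).
    by rewrite ltr_cos ?in_itv/= ?lexx ?ltW.
  apply: cos_gt0_pihalf; apply/andP; split; first by apply: lt_trans t0; lra.
  rewrite ltr_pdivrMr ?ltr0n// mulrAC ltr_pdivlMr// [ltRHS]mulrC -mulrA.
  by rewrite [pi * 2]mulrC mulrA ltr_pM2r// -natrM ltr_nat /d; lia.
have cdec j k : (j < k < m.+1)%N -> c k < c j.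
  move=> /andP[jk km].
  have [_ c2 _] := cP k km; have [c1 _ _] := cP j (ltn_trans jk km).
  apply: (lt_trans c2); apply: le_lt_trans c1.
  by rewrite ler_cos_equi_angle; rewrite /d; lia.
have [nu0 rnu nu_min] := @nuP R m.*2.+2 isT.
set v := nu R m.*2.+2 in nu0 rnu nu_min *.
have vc k : (k < m.+1)%N -> v <= c k.
  move=> km; have [_ _ rc] := cP k km.
  by apply: nu_min => //; have /andP[] := c01 k km.
have v1 : v < 1.
  by apply: (le_lt_trans (vc 0%N isT)); have /andP[] := c01 0%N isT.
have sq_lt (a b : R) : 0 < a -> a < b -> 1 - 2 * b ^+ 2 < 1 - 2 * a ^+ 2.
  by move=> a0 ab; nra.
pose s0 := [seq 1 - 2 * c k ^+ 2 | k <- iota 0 m.+1].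
have s0P y : y \in s0 -> exists2 k, (k < m.+1)%N & y = 1 - 2 * c k ^+ 2.
  by move=> /mapP[k]; rewrite mem_iota => kI ->; exists k.
have sI0 y : y \in s0 -> -1 < y < 1.
  move=> /s0P[k /c01/andP[c0 c1] ->]; apply/andP; split; nra.
have us0 : uniq s0.
  rewrite map_inj_in_uniq ?iota_uniq// => j k.
  rewrite !mem_iota/= !add0n => hj hk.
  have /andP[cj0 cj1] := c01 j hj; have /andP[ck0 ck1] := c01 k hk.
  have [jk|kj|//] := ltngtP j k.
    have := sq_lt _ _ ck0 (cdec j k _); rewrite jk hk => /(_ isT) + E.
    by rewrite E ltxx.
  have := sq_lt _ _ cj0 (cdec k j _); rewrite kj hj => /(_ isT) + E.
  by rewrite E ltxx.
have ss0 : size s0 = m.+1 by rewrite size_map size_iota.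
clearbody s0.
have us : uniq (-1 :: s0).
  by rewrite /= us0 andbT; apply/negP => /sI0/andP[]; rewrite ltxx.
have rs : all (root (radau_poly m)) (-1 :: s0).
  rewrite /=; apply/andP; split.
    apply/rootP; rewrite hornerD !hornerZ !chebyshevUN1 !exprS.
    ring.
  apply/allP => _ /s0P[k km ->]; rewrite radau_poly_deriv ?c01//.
  by have [] := cP k km.
have som : size (radau_poly m) = (size (-1 :: s0)).+1.
  by rewrite size_radau_poly /= ss0.
exists (-1 :: s0); split=> //.
- move=> y; rewrite inE => /predU1P[->|/sI0/andP[/ltW -> ->]//].
  by rewrite lexx/=; lra.
- rewrite big_cons (eq_big_seq (fun=> 2%N)); last first.
    by move=> y /sI0/andP[y1 _]; rewrite /node_mult gt_eqF.
  by rewrite big_const_seq count_predT iter_addn_0 ss0 /node_mult eqxx; lia.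
- apply: (@prod_XsubC_orthogonal _ _ _ (radau_poly m)) => //.
  move=> g; rewrite /= ss0 => sg.
  have sg1 : (size g <= m.+1)%N by move: (size g) sg => k; lia.
  rewrite mulrDl -!scalerAl cheb_functional_linear cheb_functionalZ.
  rewrite !cheb_functional_orthogonal ?mulr0 ?addr0// ?(leqW sg1)//; lia.
split.
- have : root (radau_poly m) (1 - 2 * v ^+ 2).
    by rewrite radau_poly_deriv ?nu0.
  rewrite (all_roots_prod_XsubC som rs (etrans (uniq_rootsE _) us)) rootZ.
    by rewrite root_prod_XsubC.
  by rewrite lead_coef_eq0 -size_poly_eq0 som.
- by have := sq_lt _ _ nu0 v1; rewrite expr1n; lra.
- move=> y; rewrite inE => /predU1P[->|/s0P[k km ->]].
    by have := sq_lt _ _ nu0 v1; rewrite expr1n; lra.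
  have := vc k km; rewrite le_eqVlt => /predU1P[->//|].
  by move=> /(sq_lt _ _ nu0)/ltW.
Qed.

Lemma gauss_rule_exists N : (2 <= N)%N ->
  exists s, is_gauss_rule N (a2_bound R N / 2) s.
Proof.
move=> N2; rewrite /a2_bound; case: ifPn => oN.
  have [m ->] : exists m, N = m.*2.+1 by exists N./2; lia.
  rewrite mulrAC divff ?mul1r ?pnatr_eq0//; exact: gauss_rule_odd.
have [m ->] : exists m, N = m.*2.+2 by exists N./2.-1; lia.
rewrite mulrAC divff ?mul1r ?pnatr_eq0//; exact: gauss_rule_even.
Qed.

End Nodes.

(** * Imaginary parts of complex polynomials *)

Section MinimumPrinciple.
Variable R : realType.
Implicit Types (z : R[i]) (q : {poly R[i]}) (x y r e : R).

Lemma Im_realM x z : complex.Im (x%:C%C * z) = x * complex.Im z.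
Proof. by case: z => a b /=; ring. Qed.

Lemma Im_horner_real q e :
  complex.Im q.[e%:C%C] = (map_poly (@complex.Im R) q).[e].
Proof.
have s : (size (map_poly (@complex.Im R) q) <= size q)%N by apply: size_poly.
rewrite (horner_coef_wide _ s) horner_coef raddf_sum; apply: eq_bigr => j _.
have -> : e%:C%C ^+ j = (e ^+ j)%:C%C :> R[i] by rewrite rmorphXn.
by rewrite coef_map/= mulrC Im_realM mulrC.
Qed.

Lemma Im_horner_ray q z d : exists f : {poly R},
  forall e, complex.Im q.[z + e%:C%C * d] = f.[e].
Proof.
exists (map_poly (@complex.Im R) (q \Po (z%:P + d *: 'X))) => e.
by rewrite -Im_horner_real horner_comp hornerD hornerC hornerZ hornerX mulrC.
Qed.

Lemma poly_gt0_right (f : {poly R}) :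
  0 < f.[0] -> (\forall e \near (0 : R)^'+, 0 < f.[e])%classic.
Proof.
move=> f0; have cf : (f.[e] @[e --> (0 : R)^'+] --> f.[0])%classic.
  by apply: cvg_at_right_filter; apply: continuous_horner.
exact: (cvgr_gt _ cf).
Qed.

(** Write [q = q.[z] + g * (X - z) ^ k] with [g.[z] != 0] and choose the direction
    [d] such that [d ^ k = - i * conj g.[z]]. Along [z + e d] the increment of
    [Im q] is then [- |g.[z]| ^ 2 * e ^ k] up to a term of higher order. *)
Lemma Im_horner_no_min q z : (1 < size q)%N -> exists d : R[i],
  (\forall e \near (0 : R)^'+,
    complex.Im q.[z + e%:C%C * d] < complex.Im q.[z])%classic.
Proof.
move=> q1.
have [k [g]] := multiplicity_XsubC (q - q.[z]%:P) z.
have -> /= : q - q.[z]%:P != 0.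
  apply: contraTneq q1 => /subr0_eq ->.
  by rewrite -leqNgt size_polyC leq_b1.
move=> gz qE.
have k0 : (0 < k)%N.
  rewrite lt0n; apply: contraNN gz => /eqP kE; apply/rootP.
  have := congr1 (horner^~ z) qE.
  by rewrite kE expr0 mulr1/= hornerD hornerN hornerC subrr.
pose w := - ('i%C * (g.[z])^*%C) : R[i].
pose d := k.-root w.
have dE : d ^+ k = w by apply: rootCK.
have [f fE] := Im_horner_ray (- w *: g) z d.
have f0 : 0 < f.[0].
  rewrite -fE mul0r addr0 hornerZ /w opprK.
  move: gz; rewrite /root; case: g.[z] => a b /=.
  rewrite eq_complex/= => ab0.
  rewrite [ltRHS](_ : _ = a ^+ 2 + b ^+ 2); last by ring.
  rewrite lt_def addr_ge0 ?sqr_ge0// andbT paddr_eq0 ?sqr_ge0//.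
  by rewrite !sqrf_eq0.
exists d; have fpos := poly_gt0_right f0.
near=> e.
have e0 : 0 < e by [].
have : 0 < f.[e] by near: e.
rewrite -fE hornerZ mulNr raddfN /=.
rewrite oppr_gt0 => fe.
have -> : q.[z + e%:C%C * d] = q.[z] + (e ^+ k)%:C%C * (w * g.[z + e%:C%C * d]).
  have /= := congr1 (horner^~ (z + e%:C%C * d)) qE.
  rewrite hornerD hornerN hornerC hornerM horner_exp hornerXsubC.
  rewrite [z + _ - z]addrC addKr exprMn dE => /(canRL (subrK _))->.
  by rewrite addrC rmorphXn; congr (_ + _); ring.
by rewrite raddfD/= Im_realM gtrDl pmulr_rlt0// exprn_gt0.
Unshelve. all: by end_near.
Qed.

Lemma normc_lt1 z : (`|z| < 1) = (complex.Re z ^+ 2 + complex.Im z ^+ 2 < 1).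
Proof.
by rewrite normc_def -[1]/(1%:C%C) ltcR -[X in _ < X](@sqrtr1 R) ltr_sqrt.
Qed.

End MinimumPrinciple.

(** * Typically real polynomials and nonnegative transforms *)

Section TypicallyReal.
Variable R : realType.
Implicit Types (p : {poly R}) (z : R[i]) (x y r : R).
Local Notation U := (chebyshevU R).

Definition chebyshev_transform N p : {poly R} := \sum_(j < N) p`_j.+1 *: U j.

Definition radial_transform N p r x : R :=
  \sum_(j < N) p`_j.+1 * r ^+ j * (U j).[x].

Lemma radial_transform1 N p x :
  radial_transform N p 1 x = (chebyshev_transform N p).[x].
Proof.
rewrite /radial_transform horner_sum; apply: eq_bigr => j _.
by rewrite expr1n mulr1 hornerZ.
Qed.

(** Powers of [z = r (x + i y)] obey [z ^ (j+2) = 2 r x z ^ (j+1) - r ^ 2 z ^ j],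
    which is the recurrence of the polynomials [U_j] scaled by [r]. *)
Lemma Im_exp_polar r x y j : x ^+ 2 + y ^+ 2 = 1 ->
  complex.Im ((r * x +i* (r * y))%C ^+ j.+1) = r ^+ j.+1 * y * (U j).[x].
Proof.
move=> xy; set z := (_ +i* _)%C.
have z2 : z ^+ 2 = (2 * r * x)%:C%C * z - (r ^+ 2)%:C%C.
  have -> : r ^+ 2 = r ^+ 2 * (x ^+ 2 + y ^+ 2) by rewrite xy mulr1.
  apply/eqP; rewrite eq_complex /z/= expr2.
  by apply/andP; split; apply/eqP => /=; ring.
elim/ltn_ind: j => -[_|[_|j IH]].
- by rewrite expr1 /= hornerC; ring.
- by rewrite z2 raddfB/= hornerM hornerC hornerX; ring.
have -> : z ^+ j.+3 = (2 * r * x)%:C%C * z ^+ j.+2 - (r ^+ 2)%:C%C * z ^+ j.+1.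
  by rewrite -[j.+3]/(2 + j.+1)%N exprD z2 [z ^+ j.+2]exprS; ring.
have ImB a b : complex.Im (a - b) = complex.Im a - complex.Im b :> R.
  exact: raddfB.
rewrite ImB !Im_realM IH// IH// chebyshevUSS.
by rewrite hornerD hornerN !hornerM hornerC hornerX !exprS; ring.
Qed.

Lemma Im_complex_horner N p r x y :
  (size p <= N.+1)%N -> x ^+ 2 + y ^+ 2 = 1 ->
  complex.Im (complex_horner p (r * x +i* (r * y))%C) =
  r * y * radial_transform N p r x.
Proof.
move=> sp xy; rewrite /complex_horner.
have s : (size (map_poly (real_complex R) p) <= N.+1)%N.
  by rewrite (leq_trans (size_poly _ _)).
rewrite (horner_coef_wide _ s) raddf_sum big_ord_recl/= coef_map Im_realM/=.
rewrite mulr0 add0r mulr_sumr; apply: eq_bigr => j _.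
by rewrite coef_map Im_realM Im_exp_polar// exprS /bump/=; ring.
Qed.

Lemma polar z : complex.Im z <> 0 -> exists r x y,
  [/\ 0 < r, x ^+ 2 + y ^+ 2 = 1, -1 < x < 1,
      z = (r * x +i* (r * y))%C &
      r ^+ 2 = complex.Re z ^+ 2 + complex.Im z ^+ 2].
Proof.
case: z => a b /= /eqP b0.
have ab0 : 0 < a ^+ 2 + b ^+ 2.
  by rewrite ltr_wpDl ?sqr_ge0// exprn_even_gt0.
pose r := Num.sqrt (a ^+ 2 + b ^+ 2).
have r0 : 0 < r by rewrite sqrtr_gt0.
have r2 : r ^+ 2 = a ^+ 2 + b ^+ 2 by rewrite sqr_sqrtr// ltW.
have rN0 : r != 0 by rewrite gt_eqF.
have xy : (a / r) ^+ 2 + (b / r) ^+ 2 = 1.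
  by rewrite !expr_div_n -mulrDl -r2 divff// expf_neq0.
have y0 : 0 < (b / r) ^+ 2 by rewrite exprn_even_gt0//= mulf_neq0 ?invr_neq0.
exists r, (a / r), (b / r); split=> //.
- have : (a / r) ^+ 2 < 1 by lra.
  by move: (a / r) => x x1; apply/andP; split; nra.
- by rewrite !mulrA ![r * _]mulrC !mulfK.
Qed.

Lemma poly_ge0_closure (f : {poly R}) a b : a < b ->
  (forall x, a < x < b -> 0 <= f.[x]) -> forall x, a <= x <= b -> 0 <= f.[x].
Proof.
move=> ab f0 x /andP[ax xb]; rewrite leNgt; apply/negP => fx.
have cf : {for x, continuous (horner f)} by apply: continuous_horner.
have /(@nbhs_ballP R R)[e /= e0 he] : (\forall t \near x, f.[t] < 0)%classic.
  exact: (cvgr_lt _ cf).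
have D0 : 0 < e + (b - a) by lra.
pose t := e / (e + (b - a)).
have tE : t * (e + (b - a)) = e by rewrite divfK// gt_eqF.
have t0 : 0 < t by rewrite divr_gt0.
have t1 : t < 1 by rewrite ltr_pdivrMr//; lra.
pose u := x + t * ((a + b) / 2 - x).
have : f.[u] < 0.
  apply: he; rewrite /ball/= /u opprD addrA subrr sub0r normrN.
  rewrite ltr_norml; apply/andP; split; nra.
by rewrite ltNge f0//; apply/andP; split; rewrite /u; nra.
Qed.

(** Inside the disk positivity of [Im (p z) * Im z] is that of the radial
    transform; let [r] tend to 1, then [x] to the endpoints. *)
Lemma typically_real_transform_ge0 N p :
  (size p <= N.+1)%N -> typically_real (complex_horner p) ->
  nonneg_on_itv (chebyshev_transform N p).
Proof.
move=> sp [_ _ tr].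
have rad_gt0 r x : 0 < r < 1 -> -1 < x < 1 -> 0 < radial_transform N p r x.
  move=> /andP[r0 r1] /andP[x0 x1].
  have x21 : 0 < 1 - x ^+ 2 by nra.
  pose y := Num.sqrt (1 - x ^+ 2).
  have y0 : 0 < y by rewrite sqrtr_gt0.
  have xy : x ^+ 2 + y ^+ 2 = 1 by rewrite sqr_sqrtr ?ltW//; ring.
  have := tr (r * x +i* (r * y))%C.
  rewrite normc_lt1/= !exprMn -mulrDr xy mulr1 expr_lt1// ?ltW// r1 => /(_ isT).
  rewrite (Im_complex_horner _ sp)// => H.
  have ry : 0 < r * y by rewrite mulr_gt0.
  have /H : r * y <> 0 by apply/eqP; rewrite gt_eqF.
  by rewrite mulrAC pmulr_rgt0// mulr_gt0.
apply: poly_ge0_closure; first lra.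
move=> x xI.
pose f : {poly R} := \sum_(j < N) (p`_j.+1 * (U j).[x]) *: 'X^j.
have fE r : f.[r] = radial_transform N p r x.
  rewrite horner_sum; apply: eq_bigr => j _.
  by rewrite hornerZ hornerXn; ring.
rewrite -radial_transform1 -fE.
apply: (@poly_ge0_closure f 0 1) => //; last by rewrite lexx ler01.
by move=> r rI; rewrite fE ltW// rad_gt0.
Qed.

Lemma continuous_sum (T : topologicalType) (I : Type) (s : seq I)
    (F : I -> T -> R) :
  (forall i, continuous (F i)) ->
  continuous (fun t => \sum_(i <- s) F i t).
Proof.
move=> cF; elim: s => [|i s IH].
  rewrite (_ : (fun _ => _) = cst 0); first by move=> t; apply: cvg_cst.
  by apply/funext => t; rewrite big_nil.
rewrite (_ : (fun _ => _) = fun t => F i t + \sum_(i <- s) F i t).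
  by move=> t; apply: cvgD; [apply: cF|apply: IH].
by apply/funext => t; rewrite big_cons.
Qed.

Lemma continuous_radial_transform N p :
  continuous (fun t : R * R => radial_transform N p t.1 t.2).
Proof.
apply: continuous_sum => j t.
apply: cvgM; last first.
  apply: (@cvg_comp _ _ _ snd (horner (U j))); first exact: cvg_snd.
  exact: continuous_horner.
apply: cvgM; first exact: cvg_cst.
apply: (@cvg_comp _ _ _ fst (fun r : R => r ^+ j)); first exact: cvg_fst.
exact: exprn_continuous.
Qed.

(** This is the minimum principle for [Im (p z)] on the closed upper half disk, in
    the coordinates [z = r (x + i sqrt (1 - x ^ 2))]. The function is zero on the
    diameter and nonnegative on the arc; as [p] is not constant, its minimum is
    not attained in the interior, where it is therefore positive. *)
Lemma radial_transform_gt0 N p r x :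
  (size p <= N.+1)%N -> p`_1 = 1 ->
  nonneg_on_itv (chebyshev_transform N p) ->
  0 < r < 1 -> -1 < x < 1 -> 0 < radial_transform N p r x.
Proof.
move=> sp p1 q0 rI xI.
pose y (v : R) := Num.sqrt (1 - v ^+ 2).
have y_gt0 v : -1 < v < 1 -> 0 < y v.
  by move=> /andP[x0 x1]; rewrite sqrtr_gt0; nra.
have xy v : -1 <= v <= 1 -> v ^+ 2 + y v ^+ 2 = 1.
  by move=> /andP[x0 x1]; rewrite sqr_sqrtr; [ring|nra].
pose u (t : R * R) := t.1 * y t.2 * radial_transform N p t.1 t.2.
pose A : set (R * R) := (`[0, 1] `*` `[-1, 1])%classic.
have AE (t : R * R) : (t \in A) = (0 <= t.1 <= 1) && (-1 <= t.2 <= 1).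
  by case: t => a b; rewrite in_setX !mem_setE !in_itv.
have interior_no_min r1 x1 : 0 < r1 < 1 -> -1 < x1 < 1 ->
    ~ (forall t, t \in A -> u (r1, x1) <= u t).
  move=> r1I x1I umin.
  pose q := map_poly (real_complex R) p.
  have sq : (1 < size q)%N.
    rewrite size_map_poly ltnNge; apply/negP => /leq_sizeP/(_ 1%N isT)/eqP.
    by rewrite p1 oner_eq0.
  pose z1 := (r1 * x1 +i* (r1 * y x1))%C.
  have z1Im : complex.Im z1 = r1 * y x1 by [].
  have [d dmin] := Im_horner_no_min z1 sq.
  pose a : {poly R} := (complex.Re z1)%:P + complex.Re d *: 'X.
  pose b : {poly R} := (complex.Im z1)%:P + complex.Im d *: 'X.
  have aE e : complex.Re (z1 + e%:C%C * d) = a.[e].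
    rewrite /a hornerD hornerC hornerZ hornerX.
    by case: (z1) (d) => ? ? [? ?] /=; ring.
  have bE e : complex.Im (z1 + e%:C%C * d) = b.[e].
    rewrite /b hornerD hornerC hornerZ hornerX.
    by case: (z1) (d) => ? ? [? ?] /=; ring.
  have b_gt0 : (\forall e \near (0 : R)^'+, 0 < b.[e])%classic.
    apply: poly_gt0_right; rewrite -bE mul0r addr0 z1Im.
    by rewrite mulr_gt0 ?y_gt0//; case/andP: r1I.
  have ab_lt1 : (\forall e \near (0 : R)^'+, 0 < (1 - (a ^+ 2 + b ^+ 2)).[e])%classic.
    apply: poly_gt0_right.
    rewrite hornerD hornerN hornerD !horner_exp -aE -bE mul0r addr0/=.
    rewrite !exprMn -mulrDr xy ?mulr1; last by case/andP: x1I => /ltW -> /ltW.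
    by rewrite -[1]/(1%:P) hornerC subr_gt0 expr_lt1//; case/andP: r1I => // /ltW.
  have [e [[eb eab] edec]] := filter_ex (filterI (filterI b_gt0 ab_lt1) dmin).
  have [|r2 [x2 [y2 [r20 xy2 x2I zE r2E]]]] := @polar (z1 + e%:C%C * d).
    by rewrite bE; apply/eqP; rewrite gt_eqF.
  have y20 : 0 < y2.
    by move: eb; rewrite -bE zE/= pmulr_rgt0.
  have y2E : y x2 = y2.
    by rewrite /y -xy2 addrC addKr sqrtr_sqr gtr0_norm.
  have r21 : r2 <= 1.
    rewrite -(@expr_le1 _ 2)// ?ltW// r2E aE bE.
    by move: eab; rewrite hornerD hornerN hornerD !horner_exp hornerC; lra.
  have uE (t1 t2 : R) : -1 <= t2 <= 1 ->
      u (t1, t2) = complex.Im q.[(t1 * t2 +i* (t1 * y t2))%C].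
    by move=> tI; rewrite -/(complex_horner p _) (Im_complex_horner _ sp)// xy.
  have x2I' : -1 <= x2 <= 1 by case/andP: x2I => /ltW -> /ltW.
  have := umin (r2, x2); rewrite AE/= r21 (ltW r20) x2I' => /(_ isT).
  rewrite !uE//; last by case/andP: x1I => /ltW -> /ltW.
  by rewrite y2E -zE leNgt edec.
have [[r0 x0] + umin] : exists2 c : R * R, c \in A & forall t, t \in A -> u c <= u t.
  apply: compact_EVT_min.
  - by exists (0, 0); apply/set_mem; rewrite AE/=; lra.
  - by apply: compact_setX; apply: segment_compact.
  apply: continuous_subspaceT => t.
  apply: cvgM; last exact: continuous_radial_transform.
  apply: cvgM; first exact: cvg_fst.
  apply: (@cvg_comp _ _ _ snd y); first exact: cvg_snd.
  apply: (@cvg_comp _ _ _ (fun v : R => 1 - v ^+ 2) Num.sqrt).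
    by apply: cvgB; [exact: cvg_cst|exact: exprn_continuous].
  exact: sqrt_continuous.
rewrite AE/= => /andP[/andP[r00 r01] /andP[x00 x01]].
have yx_gt0 : 0 < y x by apply: y_gt0.
have r_gt0 : 0 < r by case/andP: rI.
rewrite ltNge; apply/negP => Gx.
have urx : u (r, x) <= 0 by rewrite /u/= mulr_ge0_le0// mulr_ge0// ltW.
have [int0|bd0] := boolP ((0 < r0 < 1) && (-1 < x0 < 1)).
  by case/andP: int0 => ? ?; apply: (interior_no_min r0 x0).
have y0_ge0 : 0 <= y x0 by apply: sqrtr_ge0.
(* The four boundary pieces: the origin, the arc, and the two radii. *)
have u0 : 0 <= u (r0, x0).
  rewrite /u/=; move: bd0; rewrite !lt_def r00 r01 x00 x01 !andbT/=.
  rewrite !negb_and !negbK.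
  have yE (v : R) : v ^+ 2 = 1 -> y v = 0 by move=> ve; rewrite /y ve subrr sqrtr0.
  move=> /orP[/orP[/eqP ->|/eqP <-]|/orP[/eqP ->|/eqP <-]].
  - by rewrite mul0r mul0r.
  - by rewrite mul1r mulr_ge0// radial_transform1 q0// x00.
  - by rewrite yE ?mulr0 ?mul0r// sqrrN expr1n.
  - by rewrite yE ?mulr0 ?mul0r// expr1n.
apply: (interior_no_min r x) => // t tA.
by apply: (le_trans urx); apply: (le_trans u0); apply: umin.
Qed.

Lemma derivable_complex_horner p z :
  derivable (complex_horner p : R[i]^o -> R[i]^o) z 1.
Proof.
rewrite /complex_horner; move: (map_poly _ p) => q.
elim/poly_ind: q => [|q c IH].
  by under eq_fun do rewrite horner0; apply: derivable_cst.
under eq_fun do rewrite hornerMXaddC.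
apply: derivableD; last exact: derivable_cst.
exact: (@derivableM _ _ (horner q : R[i]^o -> R[i]^o) id z 1 IH
  (@derivable_id _ _ _ _)).
Qed.

Lemma typically_real_polyP N p : (2 <= N)%N ->
  typically_real_poly N p <->
  [/\ (size p <= N.+1)%N, p`_0 = 0, p`_1 = 1 &
      nonneg_on_itv (chebyshev_transform N p)].
Proof.
move=> N2.
have coefE (a : nat -> R) i :
    ('X + \sum_(2 <= j < N.+1) a j *: 'X^j : {poly R})`_i =
    (i == 1%N)%:R + (if (2 <= i < N.+1)%N then a i else 0).
  rewrite coefD coefX coef_sum -(@big_nat1_eq _ _ +%R a); congr (_ + _).
  rewrite [RHS]big_mkcond/=; apply: eq_bigr => j _.
  by rewrite coefZ coefXn eq_sym; case: eqP; rewrite ?mulr1 ?mulr0.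
split.
  move=> [[a pE] tr].
  have pc i : p`_i = (i == 1%N)%:R + (if (2 <= i < N.+1)%N then a i else 0).
    by rewrite pE coefE.
  have sp : (size p <= N.+1)%N.
    apply/leq_sizeP => i iN; rewrite pc.
    by rewrite [(i < _)%N]ltnNge iN andbF addr0; case: eqP => // i1; lia.
  split=> //.
  - by rewrite pc/= addr0.
  - by rewrite pc/= addr0.
  - exact: typically_real_transform_ge0.
move=> [sp p0 p1 q0]; split.
  exists (fun j => p`_j); apply/polyP => i; rewrite coefE.
  case: i => [|[|i]]; rewrite ?p0 ?p1 ?addr0// add0r.
  case: (ltnP i.+2 N.+1) => // iN.
  by rewrite nth_default// (leq_trans sp).
split.
- by move=> z _; apply: derivable_complex_horner.
- move=> z _ z0; have -> : z = (complex.Re z)%:C%C.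
    by case: z z0 => a b /= ->.
  by rewrite /complex_horner horner_map.
move=> z z1 z0; have [r [x [y [r0 xy xI zE r2]]]] := polar z0.
have r1 : r < 1 by rewrite normc_lt1 -r2 expr_lt1// in z1; rewrite ltW.
rewrite zE (Im_complex_horner _ sp)//=.
have y0 : r * y != 0 by apply/eqP => y0; apply: z0; rewrite zE.
rewrite mulrAC pmulr_rgt0 ?radial_transform_gt0// ?r0//.
by rewrite -expr2 exprn_even_gt0.
Qed.

End TypicallyReal.

(** * The second coefficient *)

Section Reflection.
Variable R : realType.
Implicit Types p : {poly R}.

Lemma chebyshevU_opp n (x : R) :
  (chebyshevU R n).[- x] = (-1) ^+ n * (chebyshevU R n).[x].
Proof.
elim/ltn_ind: n => -[_|[_|n IH]].
- by rewrite /= !hornerC expr0 mulr1.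
- by rewrite /= !hornerM !hornerC !hornerX; ring.
rewrite chebyshevUSS !hornerD !hornerN !hornerM !hornerC !hornerX.
by rewrite IH// IH// !exprS; ring.
Qed.

(** The polynomial [- p (- X)]. *)
Definition odd_reflection p : {poly R} :=
  \poly_(i < size p) ((-1) ^+ i.+1 * p`_i).

Lemma coef_odd_reflection p i : (odd_reflection p)`_i = (-1) ^+ i.+1 * p`_i.
Proof.
by rewrite coef_poly; case: ltnP => // /(nth_default 0) ->; rewrite mulr0.
Qed.

Lemma odd_reflectionK : involutive odd_reflection.
Proof.
move=> p; apply/polyP => i.
by rewrite !coef_odd_reflection mulrA -exprMn mulrNN mulr1 expr1n mul1r.
Qed.

(** Under the reflection the Chebyshev transform becomes [q (- X)]. *)
Lemma typically_real_odd_reflection N p : (2 <= N)%N ->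
  typically_real_poly N p -> typically_real_poly N (odd_reflection p).
Proof.
move=> N2 /(typically_real_polyP _ N2)[sp p0 p1 q0].
apply/(typically_real_polyP _ N2); split.
- by rewrite (leq_trans (size_poly _ _)).
- by rewrite coef_odd_reflection p0 mulr0.
- by rewrite coef_odd_reflection p1; ring.
move=> x xI; have /q0 : -1 <= - x <= 1 by lra.
congr (_ <= _); rewrite !horner_sum; apply: eq_bigr => j _.
by rewrite !hornerZ coef_odd_reflection chebyshevU_opp !exprS; ring.
Qed.

End Reflection.

Section SecondCoefficient.
Variables (R : realType) (N : nat).
Hypothesis N2 : (2 <= N)%N.
Implicit Types p : {poly R}.
Local Notation L := (cheb_functional N.+3).

Lemma coef_chebyshev_transform p j : (j < N)%N ->
  p`_j.+1 = L (chebyshevU R j * chebyshev_transform N p).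
Proof.
by move=> jN; rewrite (cheb_functional_coef (fun j => p`_j.+1)) //; lia.
Qed.

Lemma admissible_transform p :
  typically_real_poly N p -> admissible N.+3 N (chebyshev_transform N p).
Proof.
move=> /(typically_real_polyP _ N2)[sp p0 p1 q0]; split=> //.
  exact: (@size_chebyshev_sum _ N (fun j => p`_j.+1)).
by have := coef_chebyshev_transform p (ltnW N2); rewrite p1 mul1r.
Qed.

Lemma transform_admissible (q : {poly R}) : admissible N.+3 N q ->
  exists2 p, typically_real_poly N p & chebyshev_transform N p = q.
Proof.
move=> [sq q0 Lq]; have [c qE] := chebyshev_expansion sq.
pose p := \poly_(i < N.+1) (if i is j.+1 then c j else 0).
have pE : chebyshev_transform N p = q.
  rewrite qE; apply: eq_bigr => j _.
  by rewrite coef_poly ltnS ltn_ord.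
exists p => //; apply/(typically_real_polyP _ N2); split.
- exact: size_poly.
- by rewrite coef_poly.
- by have := coef_chebyshev_transform p (ltnW N2); rewrite pE mul1r Lq.
by rewrite pE.
Qed.

Lemma transform_inj p1 p2 :
  typically_real_poly N p1 -> typically_real_poly N p2 ->
  chebyshev_transform N p1 = chebyshev_transform N p2 -> p1 = p2.
Proof.
move=> /(typically_real_polyP _ N2)[s1 p10 _ _].
move=> /(typically_real_polyP _ N2)[s2 p20 _ _] E; apply/polyP => -[|i].
  by rewrite p10 p20.
have [iN|Ni] := ltnP i N; first by rewrite !coef_chebyshev_transform// E.
by rewrite !nth_default ?(leq_trans s1) ?(leq_trans s2).
Qed.

(** As [U_1 = 2 X], the second coefficient of [p] is [L (2 X q)] for the Chebyshev
    transform [q] of [p], while the normalization of [p] says that [L q = 1]. *)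
Lemma coef2_extremal :
  (forall p, typically_real_poly N p -> p`_2 <= a2_bound R N) /\
  exists! p, typically_real_poly N p /\ p`_2 = a2_bound R N.
Proof.
have [s [us sI sN orth [mus muN1 mu_max]]] := gauss_rule_exists R N2.
have [bound uniq_ext adm ext] :=
  @gauss_extremalP R N.+3 N s (leqnSn _) us sI sN orth _ mus muN1 mu_max.
have bE : 2 * (a2_bound R N / 2) = a2_bound R N by field.
rewrite bE in bound uniq_ext ext.
split=> [p pT|].
  by rewrite coef_chebyshev_transform//; apply: bound; apply: admissible_transform.
have [p pT pE] := transform_admissible adm.
exists p; split=> [|p' [p'T p'2]].
  by split=> //; rewrite coef_chebyshev_transform// pE.
apply: transform_inj => //; rewrite pE; apply/esym/uniq_ext.
  exact: admissible_transform.
by rewrite -coef_chebyshev_transform.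
Qed.

End SecondCoefficient.

Theorem theorem3p3 (R : realType) (N : nat) (hN : (2 <= N)%N) :
  [/\ forall P : {poly R},
        typically_real_poly N P -> `|P`_2| <= a2_bound R N,
      exists! P : {poly R},
        typically_real_poly N P /\ P`_2 = a2_bound R N &
      exists! P : {poly R},
        typically_real_poly N P /\ P`_2 = - a2_bound R N].
Proof.
have [bound ext] := coef2_extremal R hN.
have refl2 (P : {poly R}) : (odd_reflection P)`_2 = - P`_2.
  by rewrite coef_odd_reflection; ring.
have reflT := @typically_real_odd_reflection R N _ hN.
split=> //.
- move=> P PT; rewrite ler_norml bound// andbT lerNl -refl2.
  exact/bound/reflT.
case: ext => P [[PT P2] Puniq]; exists (odd_reflection P); split.
  by split; [exact: reflT|rewrite refl2 P2].
move=> Q [QT Q2]; rewrite (Puniq (odd_reflection Q)) ?odd_reflectionK//.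
by split; [exact: reflT|rewrite refl2 Q2 opprK].
Qed.
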